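(* Let $\Omega$ be a set and let $\mathcal{F}$ be a coherent cone of real-valued functions on $\Omega$ (the parameters of the protocol of identically priced trials). Suppose that $E\subseteq\Omega^\infty$ is a singly generated permutable event. Then $E$ is either fully plausible or unsupported (or both); that is, $\overline{\mathbb{P}}(E)=1$ or $\underline{\mathbb{P}}(E)=0$.
   Context: A coherent cone on $\Omega$ is a non-empty set $\mathcal{F}$ of real-valued functions on $\Omega$ such that: (1) $F_1,F_2\in\mathcal{F}$ implies $F_1+F_2\in\mathcal{F}$; (2) $c\ge 0$ and $F\in\mathcal{F}$ imply $cF\in\mathcal{F}$; (3) there is no $F\in\mathcal{F}$ with $F(\omega)>0$ for all $\omega\in\Omega$. Protocol of identically priced trials (parameters $\Omega$, $\mathcal{F}$): Skeptic's initial capital is $\mathcal{K}_0=1$; on each trial $n=1,2,\ldots$ Skeptic announces $F_n\in\mathcal{F}$, then Reality announces $\omega_n\in\Omega$, and $\mathcal{K}_n:=\mathcal{K}_{n-1}+F_n(\omega_n)$. A strategy for Skeptic specifies each $F_n\in\mathcal{F}$ as a function of $\omega_1\ldots\omega_{n-1}$; then $\mathcal{K}_n$ is a function of $\omega_1\ldots\omega_n$. A strategy is prudent if $\mathcal{K}_n(\omega_1\ldots\omega_n)\ge 0$ for all $\omega_1\omega_2\ldots\in\Omega^\infty$ and all $n$. An event is an arbitrary subset $E$ of the set $\Omega^\infty$ of all infinite sequences $\omega_1\omega_2\ldots$ of elements of $\Omega$ (no measurability is required). The upper probability $\overline{\mathbb{P}}(E)$ is the infimum of all $\epsilon>0$ such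 that Skeptic has a prudent strategy for which $\sup_{n=1,2,\ldots}\mathcal{K}_n(\omega_1\ldots\omega_n)\ge 1/\epsilon$ for all $\omega_1\omega_2\ldots\in E$. The lower probability is $\underline{\mathbb{P}}(E):=1-\overline{\mathbb{P}}(E^c)$, where $E^c=\Omega^\infty\setminus E$. $E$ is fully plausible if $\overline{\mathbb{P}}(E)=1$ and unsupported if $\underline{\mathbb{P}}(E)=0$. An event $E$ is permutable if for any sequence in $E$ and any $n>1$, any sequence obtained by permuting the first $n$ terms of the sequence is also in $E$. $E$ is singly generated if it is equal to the set of sequences obtained by taking a single sequence in $\Omega^\infty$ and permuting finite initial subsequences (initial segments) in all possible ways. *)

(* Defs.v *)
From HB Require Import structures.
From mathcomp Require Import all_boot all_order all_algebra perm.
From mathcomp Require Import classical_sets reals ereal.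

Set Implicit Arguments.
Unset Strict Implicit.
Unset Printing Implicit Defensive.

Import Order.TTheory GRing.Theory Num.Theory.
Local Open Scope classical_set_scope.
Local Open Scope ring_scope.

Record coherent_cone (R : realType) (Omega : Type) (F : set (Omega -> R)) : Prop :=
  CoherentCone {
    cone_nonempty : F !=set0;
    coneD : forall f g, F f -> F g -> F (fun w => f w + g w);
    coneZ : forall c f, 0 <= c -> F f -> F (fun w => c * f w);
    cone_coherent : ~ exists2 f, F f & forall w, 0 < f w }.

(* Trials are numbered from 0 here: [w i] is the outcome of trial number i + 1.
   A strategy sends the finite list of past outcomes, oldest first, to
   Skeptic's next move. *)
Definition strategy (R : realType) (Omega : Type) (F : set (Omega -> R))
    (S : seq Omega -> Omega -> R) : Prop :=
  forall h, F (S h).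

Fixpoint capital (R : realType) (Omega : Type) (S : seq Omega -> Omega -> R)
    (w : nat -> Omega) (n : nat) : R :=
  if n is m.+1 then capital S w m + S (mkseq w m) (w m) else 1.

Definition prudent (R : realType) (Omega : Type)
    (S : seq Omega -> Omega -> R) : Prop :=
  forall w n, 0 <= capital S w n.

(* The supremum is taken in the extended reals, as the capital may be
   unbounded along a sequence. *)
Definition sup_capital (R : realType) (Omega : Type)
    (S : seq Omega -> Omega -> R) (w : nat -> Omega) : \bar R :=
  ereal_sup [set (capital S w n)%:E | n in [set n | (0 < n)%N]].

(* The real-valued [inf] is a genuine infimum: for a coherent cone the set
   contains 1 (Skeptic always plays 0) and it is bounded below by 0. *)
Definition upper_prob (R : realType) (Omega : Type) (F : set (Omega -> R))
    (E : set (nat -> Omega)) : R :=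
  inf [set eps : R | 0 < eps /\
    exists S, [/\ strategy F S, prudent S &
      forall w, E w -> ((eps^-1)%:E <= sup_capital S w)%E]].

Definition lower_prob (R : realType) (Omega : Type) (F : set (Omega -> R))
    (E : set (nat -> Omega)) : R :=
  1 - upper_prob F (~` E).

Definition fully_plausible (R : realType) (Omega : Type)
    (F : set (Omega -> R)) (E : set (nat -> Omega)) : Prop :=
  upper_prob F E = 1.

Definition unsupported (R : realType) (Omega : Type)
    (F : set (Omega -> R)) (E : set (nat -> Omega)) : Prop :=
  lower_prob F E = 0.

(* [insub i : option 'I_n] is [None] when [n <= i]: those terms are unchanged. *)
Definition permute_initial (Omega : Type) (n : nat) (s : {perm 'I_n})
    (w : nat -> Omega) : nat -> Omega :=
  fun i => if insub i is Some j then w (s j) else w i.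

Definition permutable (Omega : Type) (E : set (nat -> Omega)) : Prop :=
  forall w n (s : {perm 'I_n}), E w -> (1 < n)%N -> E (permute_initial s w).

Definition singly_generated (Omega : Type) (E : set (nat -> Omega)) : Prop :=
  exists w, E = [set v | exists n (s : {perm 'I_n}), v = permute_initial s w].

(* Main.v *)
Require Import Defs.
From HB Require Import structures.
From mathcomp Require Import all_boot all_order all_algebra perm.
From mathcomp Require Import classical_sets reals ereal.
From mathcomp Require Import boolp lra.

Set Implicit Arguments.
Unset Strict Implicit.
Unset Printing Implicit Defensive.

Import Order.TTheory GRing.Theory Num.Theory.
Local Open Scope classical_set_scope.
Local Open Scope ring_scope.

(** Suppose that neither conclusion holds. Then Skeptic has a prudent strategy
    [S] that multiplies his capital by some [C > 1] on [E], and another one, [T],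
    that multiplies it by some [D > 1] off [E] ([upper_prob_lt1]). Let [E] be
    generated by [w].

    By coherence Reality can always prevent the capital of [T] from rising. Let
    her do more: as long as the capital of [T] stays at most [1], she plays an
    outcome different from that of [w] whenever she can ([evasive_play]). As [T]
    does not win, the resulting [v] is in [E], so it agrees with [w] from some
    step on. From that step on, [T] makes bets [f n] that do not gain on [v n]
    but carry the capital above [1] on every other outcome.

    If [v] does not become constant, two such bets on different outcomes
    contradict coherence ([cross_bets]): their gains on each other's outcome
    are bounded below, so the product of their losses is too, whereas the losses
    of [T] tend to zero since their sum is at most [1] ([locked_play_const]).

    If [v] is eventually constantly [a], an additional outcome different from [a]
    makes the sequence leave [E] for good, because elements of [E] contain equally
    many such outcomes. So [T] must have won at once ([deviation_wins]), which
    means that the [f n] gain at least [D - 1] off [a], at a cost on [a] that tends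
    to zero. Added in a large multiple to a bet that is bounded below and positive
    at [a], such an [f n] would give a sure gain; so bets bounded below never gain
    on [a] ([bounded_bet_le0]). The moves of prudent strategies are bounded below,
    hence neither [S] nor [T] gains anything on the sequence constantly equal to
    [a] ([capital_const_le1]). But one of them must win there. *)

(** * Capital and Reality's responses *)

Lemma eq_mkseq_prefix (Omega : Type) (u v : nat -> Omega) n :
  (forall i, (i < n)%N -> u i = v i) -> mkseq u n = mkseq v n.
Proof.
move=> uv; apply/eq_in_map => i.
by rewrite mem_iota => /andP[_]; rewrite add0n; apply: uv.
Qed.

Lemma eq_capital (R : realType) (Omega : Type) (S : seq Omega -> Omega -> R)
    (u v : nat -> Omega) n :
  (forall i, (i < n)%N -> u i = v i) -> capital S u n = capital S v n.
Proof.
elim: n => //= n IHn uv; rewrite uv// (@eq_mkseq_prefix _ u v) => [|i lt_in].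
  by rewrite IHn// => i lt_in; apply: uv; apply: ltnW.
by apply: uv; apply: ltnW.
Qed.

(** Reality may answer the next move with any [x], and the capital must remain
    nonnegative. *)
Lemma prudent_ge (R : realType) (Omega : Type) (S : seq Omega -> Omega -> R)
    (u : nat -> Omega) n x :
  prudent S -> - capital S u n <= S (mkseq u n) x.
Proof.
pose v i := if i == n then x else u i.
have uv i : (i < n)%N -> u i = v i by rewrite /v; case: ltngtP.
move=> /(_ v n.+1) /=; rewrite -(eq_capital S uv) -(eq_mkseq_prefix uv).
by rewrite /v eqxx; lra.
Qed.

Lemma sup_capital_le (R : realType) (Omega : Type)
    (S : seq Omega -> Omega -> R) (u : nat -> Omega) (C c : R) :
  (C%:E <= sup_capital S u)%E -> (forall n, capital S u n <= c) -> C <= c.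
Proof.
move=> Cle capc; rewrite -lee_fin; apply: (le_trans Cle).
by apply: ge_ereal_sup => _ [n _ <-]; rewrite lee_fin.
Qed.

Lemma coherent_le0 (R : realType) (Omega : Type) (F : set (Omega -> R)) f :
  coherent_cone F -> F f -> exists x, f x <= 0.
Proof.
move=> cF Ff; apply: contrapT => nf; apply: (cone_coherent cF); exists f => // x.
by rewrite ltNge; apply/negP => fx; apply: nf; exists x.
Qed.

(** Reality as a player: she can follow [u] for [n] trials and then choose each
    outcome by a rule that depends on the past. *)
Lemma reality_play (Omega : Type) (P : seq Omega -> Omega -> Prop)
    (u : nat -> Omega) n :
  (forall h, exists x, P h x) ->
  exists v, (forall i, (i < n)%N -> v i = u i) /\
            (forall i, (n <= i)%N -> P (mkseq v i) (v i)).
Proof.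
move=> /choice[r rP].
pose next h := if (size h < n)%N then u (size h) else r h.
pose past := fix past i := if i is j.+1 then rcons (past j) (next (past j))
                           else [::].
pose v i := next (past i).
have pastE i : mkseq v i = past i by elim: i => // i IHi; rewrite mkseqS IHi.
have vE i : v i = next (mkseq v i) by rewrite pastE.
exists v; split=> i ni; rewrite vE /next size_mkseq; first by rewrite ni.
by rewrite ltnNge ni; apply: rP.
Qed.

(** By coherence each move of Skeptic admits an outcome on which it does not
    gain. *)
Lemma capped_continuation (R : realType) (Omega : Type)
    (F : set (Omega -> R)) (S : seq Omega -> Omega -> R) u n :
  coherent_cone F -> strategy F S ->
  exists v, (forall i, (i < n)%N -> v i = u i) /\
            (forall m, (n <= m)%N -> capital S v m <= capital S u n).
Proof.
move=> cF FS.
have [v [vu vS]] := @reality_play _ (fun h x => S h x <= 0) u n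
  (fun h => coherent_le0 cF (FS h)).
exists v; split=> // m /subnKC <-; elim: (m - n)%N => [|k IHk].
  by rewrite addn0 (eq_capital S vu).
rewrite addnS /=; have := vS _ (leq_addr k n); lra.
Qed.

(** Reality deviates from [w] whenever the capital stays at most [1] after some
    deviation, and otherwise answers with an outcome that does not gain. That
    outcome keeps the capital at most [1] too, so it can only be the one of [w]. *)
Lemma evasive_play (R : realType) (Omega : Type) (F : set (Omega -> R))
    (T : seq Omega -> Omega -> R) (w : nat -> Omega) :
  coherent_cone F -> strategy F T ->
  exists v, (forall n, capital T v n <= 1) /\
    (forall n, v n = w n -> T (mkseq v n) (w n) <= 0 /\
       forall x, x <> w n -> 1 < capital T v n + T (mkseq v n) x).
Proof.
move=> cF FT.
pose Q h x := capital T (nth (w 0%N) h) (size h) + T h x <= 1.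
pose P h x := (Q h x /\ x <> w (size h)) \/
  ((forall y, Q h y -> y = w (size h)) /\ T h x <= 0).
have exP h : exists x, P h x.
  have [[x Qx]|nQ] := pselect (exists x, Q h x /\ x <> w (size h)).
    by exists x; left.
  have [x Tx] := coherent_le0 cF (FT h); exists x; right; split=> // y Qy.
  by apply: contrapT => yw; apply: nQ; exists y.
have [v [_ vP]] := reality_play w 0 exP.
have QE n x : Q (mkseq v n) x = (capital T v n + T (mkseq v n) x <= 1).
  rewrite /Q size_mkseq (@eq_capital _ _ T _ v)// => i lt_in.
  by rewrite nth_mkseq.
exists v; split=> [|n vw].
  elim=> //= n IHn; have [[]|[_]] := vP n isT; first by rewrite QE.
  by lra.
have [[_]|[]] := vP n isT; rewrite size_mkseq vw// => onlyw Tw; split=> // x xw.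
by rewrite ltNge -QE; apply/negP => /onlyw.
Qed.

(** * Coherent bets and vanishing losses *)

(** Were the inequality to fail, the two bets could be weighted so that each
    more than makes up for the loss of the other, a sure gain. *)
Lemma cross_bets (R : realType) (Omega : Type) (F : set (Omega -> R)) f g a b :
  coherent_cone F -> F f -> F g ->
  f a <= 0 -> (forall x, x <> a -> 0 < f x) ->
  g b <= 0 -> (forall x, x <> b -> 0 < g x) ->
  a <> b -> f b * g a <= f a * g b.
Proof.
move=> cF Ff Fg fa f_gt0 gb g_gt0 ab; rewrite leNgt; apply/negP => lt_fg.
have fb : 0 < f b by apply: f_gt0 => /esym.
have ga : 0 < g a by apply: g_gt0.
apply: (cone_coherent cF).
(* With these weights the value at [a] and the value at [b] are both equal to
   [f b * g a - f a * g b]. *)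
exists (fun x => (g a - g b) * f x + (f b - f a) * g x).
  by apply: (coneD cF (f := fun x => _ * f x) (g := fun x => _ * g x));
    apply: (coneZ cF) => //; lra.
move=> x; have [->|xa] := pselect (x = a); first by nra.
have [->|xb] := pselect (x = b); first by nra.
have := f_gt0 _ xa; have := g_gt0 _ xb; nra.
Qed.

(** Elementary form of the fact that a nonnegative, eventually nonincreasing
    sequence converges. *)
Lemma vanishing_decrements (R : realType) (u : nat -> R) N e :
  (forall n, (N <= n)%N -> u n.+1 <= u n) -> (forall n, 0 <= u n) -> 0 < e ->
  exists M, forall n, (M <= n)%N -> u n - u n.+1 < e.
Proof.
move=> dec u_ge0 e_gt0; pose A := [set u n | n in [set n | (N <= n)%N]].
have infA : has_inf A.
  by split; [exists (u N), N => /= | exists 0 => _ [n _ <-]].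
have [_ [M /= NM <-] uM] := inf_adherent e_gt0 infA.
exists M => n Mn.
have le_uM : u n <= u M.
  rewrite -(subnKC Mn); elim: (n - M)%N => [|k IHk]; first by rewrite addn0.
  rewrite addnS; apply: le_trans (dec _ _) IHk.
  by rewrite (leq_trans NM)// leq_addr.
have : inf A <= u n.+1.
  apply: ge_inf; first by case: infA.
  by exists n.+1 => //=; rewrite (leq_trans NM)// (leq_trans Mn).
lra.
Qed.

(** A bet gaining at [a] and bounded below becomes a sure gain once a large
    multiple of a bet gaining at least [eta] off [a] is added, provided that the
    latter costs little at [a]. *)
Lemma bounded_bet_le0 (R : realType) (Omega : Type) (F : set (Omega -> R)) a eta :
  coherent_cone F -> 0 < eta ->
  (forall e, 0 < e -> exists f, [/\ F f, - e < f a &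
     forall x, x <> a -> eta <= f x]) ->
  forall g B, F g -> (forall x, - B <= g x) -> g a <= 0.
Proof.
move=> cF eta_gt0 cheap g B Fg gB; rewrite leNgt; apply/negP => ga.
have B_ge0 : 0 <= `|B| by [].
have BB : B <= `|B| by exact: ler_norm.
(* The multiple that outweighs the bound [B] off [a]. *)
pose M := (`|B| + 1) / eta.
have M_gt0 : 0 < M by apply: divr_gt0 => //; lra.
have Meta : M * eta = `|B| + 1 by rewrite divfK// gt_eqF.
have [f [Ff fa f_eta]] := cheap (g a / M) (divr_gt0 ga M_gt0).
apply: (cone_coherent cF); exists (fun x => M * f x + g x).
  by apply: (coneD cF (f := fun x => M * f x)) => //; apply: (coneZ cF) => //;
    apply: ltW.
move=> x; have [->|xa] := pselect (x = a).
  have : M * (- (g a / M)) < M * f a by rewrite ltr_pM2l.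
  by rewrite mulrN mulrC divfK ?gt_eqF//; lra.
have : M * eta <= M * f x by rewrite ler_pM2l// f_eta.
have := gB x; lra.
Qed.

Lemma capital_const_le1 (R : realType) (Omega : Type) (F : set (Omega -> R))
    (S : seq Omega -> Omega -> R) a :
  (forall g B, F g -> (forall x, - B <= g x) -> g a <= 0) ->
  strategy F S -> prudent S -> forall n, capital S (fun=> a) n <= 1.
Proof.
move=> le0 FS prS; elim=> //= n IHn.
have := le0 _ _ (FS (mkseq (fun=> a) n)) (fun x => prudent_ge _ _ _ prS).
lra.
Qed.

(** * Finite permutations of a sequence *)

Lemma permute_initial_id (Omega : Type) n (s : {perm 'I_n})
    (w : nat -> Omega) i : (n <= i)%N -> permute_initial s w i = w i.
Proof. by move=> ni; rewrite /permute_initial insubF// ltnNge ni. Qed.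

Lemma count_permute_initial (Omega : Type) (p : pred Omega) n
    (s : {perm 'I_n}) (w : nat -> Omega) m : (n <= m)%N ->
  (\sum_(0 <= i < m) p (permute_initial s w i) = \sum_(0 <= i < m) p (w i))%N.
Proof.
move=> nm; rewrite !(@big_cat_nat _ _ _ n 0 m)//=; congr (_ + _)%N.
  rewrite !big_mkord [RHS](reindex_inj (@perm_inj _ s)) /=.
  by apply: eq_bigr => i _; rewrite /permute_initial valK.
by apply: eq_big_nat => i /andP[ni _]; rewrite permute_initial_id.
Qed.

(** If [v] is constantly [a] from step [n] on, then the outcomes different from
    [a] that [w] has to offer all occur in the first [n] terms of [v], which are
    those of [v']. None is left for step [n] of [v']. *)
Lemma permutations_same_tail (Omega : Type) (w v v' : nat -> Omega) a n
    k (s : {perm 'I_k}) k' (s' : {perm 'I_k'}) :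
  v = permute_initial s w -> v' = permute_initial s' w ->
  (forall i, (n <= i)%N -> v i = a) -> (forall i, (i < n)%N -> v' i = v i) ->
  v' n = a.
Proof.
move=> vE v'E va v'v; apply: contrapT => v'a.
pose p x : bool := `[< x <> a >]; pose m := (n.+1 + k + k')%N.
have nm : (n < m)%N by rewrite /m -addnA leq_addr.
have : (\sum_(0 <= i < m) p (v i) = \sum_(0 <= i < m) p (v' i))%N.
  rewrite vE v'E !count_permute_initial// ?leq_addl//.
  by rewrite /m addnAC leq_addl.
rewrite !(@big_cat_nat _ _ _ n 0 m) ?(ltnW nm)//=.
rewrite (@eq_big_nat _ _ _ 0 n _ (fun i => nat_of_bool (p (v' i)))); last first.
  by move=> i /andP[_ lt_in]; rewrite v'v.
move/addnI; rewrite big1_seq => [|i]; last first.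
  rewrite mem_index_iota => /andP[_ /andP[ni _]].
  by rewrite va// /p asboolF// => /(_ erefl).
by rewrite big_ltn// /p asboolT.
Qed.

(** * The two strategies cannot both win *)

(** The steps [n >= N] of a play are locked when every outcome other than [v n]
    would bring Skeptic above his initial capital. If [v] does not become constant,
    the first loss is strict by [cross_bets], so that from then on every deviation
    must gain more than a fixed [d > 0], and the product of two losses on
    different outcomes is at least [d ^+ 2]. This is impossible, as the later of
    the two losses can be chosen arbitrarily small: Skeptic can lose his capital
    only once. *)
Lemma locked_play_const (R : realType) (Omega : Type) (F : set (Omega -> R))
    (f : nat -> Omega -> R) (K : nat -> R) (v : nat -> Omega) N :
  coherent_cone F -> (forall n, F (f n)) ->
  (forall n, K n.+1 = K n + f n (v n)) -> (forall n, 0 <= K n <= 1) ->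
  (forall n, (N <= n)%N -> f n (v n) <= 0) ->
  (forall n x, (N <= n)%N -> x <> v n -> 1 - K n < f n x) ->
  exists a M, forall n, (M <= n)%N -> v n = a.
Proof.
move=> cF Ff KS K01 loss gain; apply: contrapT => nconst.
have K_ge0 n : 0 <= K n by case/andP: (K01 n).
have K_le1 n : K n <= 1 by case/andP: (K01 n).
have decK n : (N <= n)%N -> K n.+1 <= K n by move=> /loss; rewrite KS; lra.
have gain_gt0 n x : (N <= n)%N -> x <> v n -> 0 < f n x.
  by move=> Nn /(gain _ _ Nn); have := K_le1 n; lra.
have differ m M : exists n, (M <= n)%N /\ v n <> v m.
  apply: contrapT => nd; apply: nconst; exists (v m), M => n Mn.
  by apply: contrapT => nm; apply: nd; exists n.
have cross m n : (N <= m)%N -> (N <= n)%N -> v n <> v m ->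
    f m (v n) * f n (v m) <= f m (v m) * f n (v n).
  move=> Nm Nn vnm; apply: (cross_bets cF (Ff m) (Ff n)).
  - exact: loss.
  - by move=> x; apply: gain_gt0.
  - exact: loss.
  - by move=> x; apply: gain_gt0.
  - by move/esym.
have K1 : K N.+1 < 1.
  have [n [Nn vnN]] := differ N N.
  have := cross N n (leqnn N) Nn vnN.
  have := gain_gt0 N (v n) (leqnn _) vnN.
  have := gain_gt0 n (v N) Nn (nesym vnN).
  have := loss N (leqnn _); have := loss n Nn; have := K_le1 N.
  by rewrite KS; nra.
pose d := 1 - K N.+1; have d_gt0 : 0 < d by rewrite /d; lra.
have gaind n x : (N < n)%N -> x <> v n -> d < f n x.
  move=> Nn /(gain n x (ltnW Nn)).
  have : K n <= K N.+1; last by rewrite /d; lra.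
  rewrite -(subnKC Nn); elim: (n - N.+1)%N => [|k IHk]; first by rewrite addn0.
  by rewrite addnS; apply: le_trans (decK _ _) IHk; rewrite addSnnS leq_addr.
pose p := - f N.+1 (v N.+1).
have p_ge0 : 0 <= p by rewrite /p; have := loss N.+1 (leqnSn N); lra.
(* [p] is the fixed loss; [p + 1] avoids dividing by zero. *)
have e_gt0 : 0 < d ^+ 2 / (p + 1) by apply: divr_gt0; [apply: exprn_gt0|lra].
have [M MP] := vanishing_decrements decK K_ge0 e_gt0.
have [n [Mn vn]] := differ N.+1 (maxn M N.+1).
have [{}Mn Nn] : (M <= n)%N /\ (N < n)%N by apply/andP; rewrite -geq_max.
have := cross N.+1 n (leqnSn N) (ltnW Nn) vn.
have := gaind N.+1 (v n) (ltnSn N) vn.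
have := gaind n (v N.+1) Nn (nesym vn).
have : (p + 1) * - f n (v n) < d ^+ 2.
  have p1 : 0 < p + 1 by lra.
  by rewrite mulrC -ltr_pdivlMr//; have := MP n Mn; rewrite KS; lra.
have := loss n (ltnW Nn); rewrite /p.
move: (f N.+1 (v N.+1)) (f n (v n)) (f N.+1 (v n)) (f n (v N.+1)) => y z q r.
rewrite expr2; move=> z0 yz rd qd.
have : d * d < q * r by rewrite ltr_pM// ltW.
nra.
Qed.

(** After the deviation to [x] there are more outcomes different from
    [a] than in [w], so the sequence leaves [E] however it goes on. Were the
    capital below [D], Reality could keep it from rising any further, and
    Skeptic would not win. *)
Lemma deviation_wins (R : realType) (Omega : Type) (F : set (Omega -> R))
    (T : seq Omega -> Omega -> R) (w v : nat -> Omega) (D : R) a n x :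
  let E := [set v | exists n (s : {perm 'I_n}), v = permute_initial s w] in
  coherent_cone F -> strategy F T ->
  (forall u, ~ E u -> (D%:E <= sup_capital T u)%E) ->
  E v -> (forall m, capital T v m < D) ->
  (forall i, (n <= i)%N -> v i = a) -> x <> a ->
  D <= capital T v n + T (mkseq v n) x.
Proof.
move=> E cF FT winT [k [s vE]] vD va xa; rewrite leNgt; apply/negP => ltD.
pose u i := if i == n then x else v i.
have uv i : (i < n)%N -> u i = v i by rewrite /u; case: ltngtP.
have uS : capital T u n.+1 = capital T v n + T (mkseq v n) x.
  by rewrite /= (eq_capital T uv) (eq_mkseq_prefix uv) /u eqxx.
have [v' [v'u v'T]] := capped_continuation u n.+1 cF FT.
have v'v i : (i < n)%N -> v' i = v i.
  by move=> lt_in; rewrite v'u ?uv// ltnW.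
have [k' [s' v'E]] : E v'.
  apply: contrapT => /winT /sup_capital_le winv'.
  pose c := \big[Num.max/capital T u n.+1]_(i < n.+1) capital T v i.
  have : D <= c.
    apply: winv' => m; have [nm|mn] := ltnP n m.
      by apply: le_trans (v'T m nm) _; apply: bigmax_ge_id.
    rewrite (@eq_capital _ _ T v' v) => [|i im]; last first.
      by apply: v'v; apply: leq_trans mn.
    exact: (le_bigmax _ (fun i : 'I_n.+1 => capital T v i)
      (Ordinal (mn : m < n.+1)%N)).
  by rewrite leNgt bigmax_lt// uS.
by apply: xa; rewrite -(permutations_same_tail vE v'E va v'v) v'u// /u eqxx.
Qed.

(** Reality's evasive play against [T] keeps the capital at most [1], so it ends
    in the event, hence follows [w] from some step on: the play is locked. By
    [locked_play_const] it is then constantly [a] from some step on, and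
    [deviation_wins] and [vanishing_decrements] turn the moves of [T] into
    the cheap bets of [bounded_bet_le0]. Hence no prudent strategy gains on the
    sequence constantly equal to [a], whichever of the two strategies is meant
    to win there. *)
Lemma no_double_win (R : realType) (Omega : Type) (F : set (Omega -> R))
    (w : nat -> Omega) (S T : seq Omega -> Omega -> R) (C D : R) :
  let E := [set v | exists n (s : {perm 'I_n}), v = permute_initial s w] in
  coherent_cone F -> strategy F S -> prudent S -> strategy F T -> prudent T ->
  1 < C -> 1 < D ->
  (forall v, E v -> (C%:E <= sup_capital S v)%E) ->
  ~ (forall v, ~ E v -> (D%:E <= sup_capital T v)%E).
Proof.
move=> E cF FS prS FT prT C1 D1 winS winT.
have inE v : (forall n, capital T v n <= 1) -> E v.
  move=> vc; apply: contrapT => /winT Dv.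
  by have := sup_capital_le Dv vc; lra.
have [v [v1 vw]] := evasive_play w cF FT.
have Ev := inE v v1; have [N [s vE]] := Ev.
pose f n := T (mkseq v n); pose K n := capital T v n.
have vwN n : (N <= n)%N -> v n = w n.
  by move=> Nn; rewrite vE permute_initial_id.
have loss n : (N <= n)%N -> f n (v n) <= 0.
  by move=> Nn; have [] := vw n (vwN n Nn); rewrite -vwN.
have gain n x : (N <= n)%N -> x <> v n -> 1 - K n < f n x.
  move=> Nn; have [_] := vw n (vwN n Nn) => /(_ x); rewrite -vwN// => h /h.
  by rewrite /f /K; lra.
have KS n : K n.+1 = K n + f n (v n) by [].
have K01 n : 0 <= K n <= 1 by rewrite prT v1.
have [a [M va]] :=
  locked_play_const cF (fun n => FT (mkseq v n)) KS K01 loss gain.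
have D1_gt0 : 0 < D - 1 by lra.
have decK n : (N <= n)%N -> K n.+1 <= K n by move=> /loss; rewrite KS; lra.
have le0 : forall g B, F g -> (forall x, - B <= g x) -> g a <= 0.
  apply: (bounded_bet_le0 cF D1_gt0) => e.
  move=> /(vanishing_decrements decK (prT v))[M' M'P].
  exists (f (maxn M M')); split; first exact: FT.
  - rewrite -(va (maxn M M')) ?leq_maxl//.
    by have := M'P _ (leq_maxr M M'); rewrite KS; lra.
  move=> x xa; have vD m : capital T v m < D := le_lt_trans (v1 m) D1.
  have := @deviation_wins _ _ _ _ _ _ _ a (maxn M M') x cF FT winT Ev vD.
  have := v1 (maxn M M'); rewrite /f => K1 devD.
  suff : D <= capital T v (maxn M M') + T (mkseq v (maxn M M')) x by lra.
  by apply: devD => // i; rewrite geq_max => /andP[/va].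
have Ea : E (fun=> a) := inE _ (capital_const_le1 le0 FT prT).
have := sup_capital_le (winS _ Ea) (capital_const_le1 le0 FS prS); lra.
Qed.

(** * The dichotomy *)

(** Never betting shows that an upper probability is at most [1], so one other
    than [1] is smaller than [1]. *)
Lemma upper_prob_lt1 (R : realType) (Omega : Type) (F : set (Omega -> R))
    (E : set (nat -> Omega)) :
  coherent_cone F -> upper_prob F E <> 1 ->
  exists C S, [/\ 1 < C, strategy F S, prudent S &
    forall w, E w -> (C%:E <= sup_capital S w)%E].
Proof.
move=> cF; rewrite /upper_prob; set A := [set eps | _] => neq1.
have lbA : has_lbound A by exists 0 => e [/ltW].
have A1 : A 1.
  split=> //; have [f Ff] := cone_nonempty cF.
  pose S0 (h : seq Omega) (x : Omega) : R := 0.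
  have cap0 u n : capital S0 u n = 1.
    by elim: n => //= n ->; rewrite addr0.
  exists S0; split=> [h|u n|u _]; last 2 first.
  - by rewrite cap0.
  - by apply: ereal_sup_ubound; exists 1%N => //; rewrite cap0 invr1.
  suff -> : S0 h = (fun x => 0 * f x) by apply: (coneZ cF).
  by apply/funext => x; rewrite mul0r.
have lt1 : inf A < 1.
  by rewrite lt_neqAle; apply/andP; split; [exact/eqP | exact: ge_inf].
have [e [e_gt0 [S [FS prS winS]]] e1] :=
  inf_lt (ex_intro _ 1 A1 : A !=set0) lt1.
by exists e^-1, S; split=> //; rewrite invf_gt1.
Qed.

Theorem proposition1 (R : realType) (Omega : Type) (F : set (Omega -> R))
    (coherentF : coherent_cone F) (E : set (nat -> Omega))
    (permE : permutable E) (genE : singly_generated E) :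
  fully_plausible F E \/ unsupported F E.
Proof.
have [?|/(upper_prob_lt1 coherentF)[C [S [C1 FS prS winS]]]] :=
  pselect (upper_prob F E = 1); first by left.
right; rewrite /unsupported /lower_prob.
have [->|/(upper_prob_lt1 coherentF)[D [T [D1 FT prT winT]]]] :=
  pselect (upper_prob F (~` E) = 1); first by rewrite subrr.
have [w Ew] := genE; subst E.
by case: (no_double_win coherentF FS prS FT prT C1 D1 winS winT).
Qed.
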